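(* For every positive integer $k$, there exists a constant $c_k > 0$ such that for every positive integer $n$, there exists a graph $G$ with $\mathrm{pw}(G) \leq k$ that contains $P_n$ as a subgraph but the longest induced path in $G$ is of order at most $c_k \cdot n^{1/k}$.
   Context: Graphs are finite and simple. $P_n$ denotes the path on $n$ vertices; the order of a path is its number of vertices. An induced path in $G$ is a path that is an induced subgraph of $G$. An interval graph is an intersection graph of finite intervals of the real line. The pathwidth $\mathrm{pw}(G)$ of a graph $G$ is the minimum non-negative integer $p$ such that there exists an interval graph $I$ of clique number $p+1$ such that $G$ is a subgraph of $I$ (equivalent to the usual definition via path decompositions). *)

(* Defs.v *)
From HB Require Import structures.
From mathcomp Require Import all_boot all_order all_algebra.
From mathcomp Require Import all_classical all_reals all_analysis.

Set Implicit Arguments.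
Unset Strict Implicit.
Unset Printing Implicit Defensive.

Import Order.TTheory GRing.Theory Num.Theory.
Import numFieldNormedType.Exports.

Local Open Scope classical_set_scope.
Local Open Scope ring_scope.

Record sgraph := SGraph {
  vertex :> finType;
  edge : rel vertex;
  edge_sym : symmetric edge;
  edge_irr : irreflexive edge }.

(* Up to isomorphism: H has a (not necessarily spanning) subgraph isomorphic
   to G, resp. an induced subgraph isomorphic to G. *)
Definition is_subgraph (G H : sgraph) : Prop :=
  exists f : G -> H, injective f /\ forall x y, edge x y -> edge (f x) (f y).

Definition is_induced_subgraph (G H : sgraph) : Prop :=
  exists f : G -> H, injective f /\ forall x y, edge x y = edge (f x) (f y).

Definition path_edge (n : nat) : rel 'I_n :=
  fun i j => (i.+1 == j :> nat) || (j.+1 == i :> nat).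

Lemma path_edge_sym n : symmetric (@path_edge n).
Proof. by move=> i j; rewrite /path_edge orbC. Qed.

Lemma path_edge_irr n : irreflexive (@path_edge n).
Proof. by move=> i; rewrite /path_edge orbb eqn_leq ltnn. Qed.

(* The order n is the number of vertices. *)
Definition path_graph (n : nat) : sgraph :=
  SGraph (@path_edge_sym n) (@path_edge_irr n).

(* The bound on m loses nothing: an induced subgraph of G has at most #|G|
   vertices. *)
Definition longest_induced_path (G : sgraph) : nat :=
  (\max_(m < #|G|.+1 | `[< is_induced_subgraph (path_graph m) G >]) m)%N.

Definition is_clique (G : sgraph) (A : {set G}) : bool :=
  [forall x in A, forall y in A, (x != y) ==> edge x y].

Definition clique_number (G : sgraph) : nat :=
  (\max_(A : {set G} | is_clique A) #|A|)%N.

(* Intervals may be open, closed or half-open. *)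
Definition finite_interval (R : realType) (A : set R) : Prop :=
  [/\ A !=set0, is_interval A & bounded_set A].

Definition interval_graph (R : realType) (G : sgraph) : Prop :=
  exists I : G -> set R, (forall x, finite_interval (I x)) /\
    forall x y, x != y -> edge x y <-> I x `&` I y !=set0.

Definition has_interval_supergraph (R : realType) (G : sgraph) (p : nat) :
    Prop :=
  exists I : sgraph,
    [/\ interval_graph R I, clique_number I = p.+1 & is_subgraph G I].

Definition complete_edge (T : finType) : rel T := fun x y => x != y.

Lemma complete_edge_sym T : symmetric (@complete_edge T).
Proof. by move=> x y; rewrite /complete_edge eq_sym. Qed.

Lemma complete_edge_irr T : irreflexive (@complete_edge T).
Proof. by move=> x; rewrite /complete_edge eqxx. Qed.

Definition complete_graph (T : finType) : sgraph :=
  SGraph (@complete_edge_sym T) (@complete_edge_irr T).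

Lemma interval_supergraph_exists (R : realType) (G : sgraph) :
  exists p, `[< has_interval_supergraph R G p >].
Proof.
exists #|G|; apply/asboolP; exists (complete_graph (option G)); split.
- exists (fun=> [set 0]); split=> [_|x y xy]; last first.
    by split=> // _; exists 0.
  split; first by exists 0.
  + move=> x y /= -> -> z /andP[z0 z1].
    by apply/eqP; rewrite eq_le z0 z1.
  + exact: (compact_bounded (@compact_set1 R 0)).
- apply/eqP; rewrite -card_option eqn_leq; apply/andP; split.
    by apply/bigmax_leqP => A _; exact: max_card.
  rewrite -cardsT; apply: (@leq_bigmax_cond _ _ (fun A : {set _} => #|A|)).
  by apply/forall_inP => x _; apply/forall_inP => y _; apply/implyP.
- exists Some; split=> [x y [] //|x y xy].
  by apply/eqP => -[xy0]; rewrite xy0 edge_irr in xy.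
Qed.

(* The minimum p such that G is a subgraph of an interval graph of clique
   number p + 1. *)
Definition pathwidth (R : realType) (G : sgraph) : nat :=
  ex_minn (interval_supergraph_exists R G).

(* Main.v *)
(** Fix [b] with [n <= b ^ k] and let [w x] be the largest [b ^ j] with
    [j < k] that divides [x]. Take the intersection graph of the intervals
    [[x, x + w x]], [x < n], in which [x] and [x + 1] are always adjacent. The
    intervals of one width abut, so among those containing a point and starting
    strictly before it there is at most one per width: cliques have at most
    [k + 1] vertices. The intervals are also laminar up to endpoints. In an
    induced path no interval of an inner vertex is nested in that of a
    neighbour, so consecutive inner intervals abut and, up to reversal, the
    inner part of the path is an orbit of [x |-> x + w x]. The width never
    decreases along an orbit, and after at most [b] steps at one width the next
    power of [b] divides [x], so [k * b] steps lead beyond [b ^ k >= n]. *)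

Require Import Defs.
From mathcomp Require Import all_boot all_order all_algebra.
From mathcomp Require Import all_classical all_reals all_analysis.
From mathcomp Require Import zify.

Import Order.TTheory GRing.Theory Num.Theory.
Local Open Scope ring_scope.

(** * Interval widths and orbits of [base_succ] *)

Section BaseIntervals.
Local Open Scope nat_scope.
Variables (b k : nat).
Hypotheses (b_gt0 : 0 < b) (k_gt0 : 0 < k).

Definition base_width (x : nat) : nat := \max_(j < k | b ^ j %| x) b ^ j.
Local Notation w := base_width.

Definition base_succ (x : nat) : nat := x + w x.
Local Notation s := base_succ.

Lemma base_widthP x : exists j, [/\ j < k, w x = b ^ j & b ^ j %| x].
Proof.
have k0 : 0 < #|[pred j : 'I_k | b ^ j %| x]|.
  by apply/card_gt0P; exists (Ordinal k_gt0); rewrite inE expn0 dvd1n.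
have [j jx wj] := eq_bigmax_cond (fun j : 'I_k => b ^ j) k0.
by exists j; split.
Qed.

Lemma dvdn_base_width x : w x %| x.
Proof. by have [j [_ ->]] := base_widthP x. Qed.

Lemma leq_base_width j x : j < k -> b ^ j %| x -> b ^ j <= w x.
Proof.
by move=> jk; apply: (leq_bigmax_cond (F := fun j : 'I_k => b ^ j) (Ordinal jk)).
Qed.

Lemma base_width_gt0 x : 0 < w x.
Proof. by have [j [_ -> _]] := base_widthP x; rewrite expn_gt0 b_gt0. Qed.

(** The last premise is guarded because multiples of [b ^ k] still get the top width [b ^ k.-1]. *)
Lemma base_widthE j x : j < k -> b ^ j %| x ->
  (j.+1 < k -> ~~ (b ^ j.+1 %| x)) -> w x = b ^ j.
Proof.
move=> jk jx jNx; apply/eqP; rewrite eqn_leq leq_base_width // andbT.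
have [i [ik -> ix]] := base_widthP x; rewrite leq_pexp2l //.
rewrite leqNgt; apply/negP => ji; apply/negP: (jNx (leq_ltn_trans ji ik)).
rewrite negbK; exact: dvdn_trans (dvdn_exp2l _ ji) ix.
Qed.

Lemma dvdn_gap d x y : d %| x -> d %| y -> x < y -> x + d <= y.
Proof.
move=> dx dy xy; rewrite -leq_subRL ?(ltnW xy) //.
by apply: dvdn_leq; rewrite ?subn_gt0 // dvdn_sub.
Qed.

(** Of two powers of [b] one divides the other. If [w y] divides [w x], then [s x] is a multiple of
    [w y] above [y]; otherwise [w x] divides [y], which cannot lie strictly between [x] and
    [x + w x]. *)
Lemma base_succ_laminar x y : x < y -> y < s x -> s y <= s x.
Proof.
move=> xy ysx; have [j [_ wx jx]] := base_widthP x.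
have [i [_ wy iy]] := base_widthP y; rewrite /s wy.
apply: dvdn_gap => //; rewrite /base_succ wx.
have [ij|/ltnW ji] := leqP i j.
  by rewrite dvdn_add ?(dvdn_trans (dvdn_exp2l b ij)).
have jy : b ^ j %| y by exact: dvdn_trans (dvdn_exp2l b ji) iy.
by move: ysx; rewrite /base_succ wx ltnNge dvdn_gap.
Qed.

Lemma leq_iter_base_succ i x : x <= iter i s x.
Proof. by elim: i => //= i /leq_trans; apply; exact: leq_addr. Qed.

Lemma leq_iter_base_succ2 i j x : i <= j -> iter i s x <= iter j s x.
Proof. by move=> /subnK <-; rewrite iterD leq_iter_base_succ. Qed.

(** Until a multiple of [b ^ j.+1] is met every step has length exactly [b ^ j], so none is jumped
    over. *)
Lemma iter_base_succ_dvd j r x : j.+1 < k -> b ^ j %| x ->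
  b ^ j.+1 %| x + r * b ^ j -> exists2 i, i <= r & b ^ j.+1 %| iter i s x.
Proof.
move=> jk; elim: r x => [|r IH] x jx; first by rewrite addn0; exists 0.
have [j1x _|jNx] := boolP (b ^ j.+1 %| x); first by exists 0.
rewrite mulSn addnA => xr.
have sx : s x = x + b ^ j by rewrite /base_succ (base_widthE j) // ltnW.
have [||i ir isx] := IH (s x).
- by rewrite sx dvdn_add.
- by rewrite sx.
by exists i.+1; rewrite // iterSr.
Qed.

(** Each of the [k - j] remaining widths takes at most [b] steps; at the top one, [b] steps of
    [b ^ k.-1] cover [b ^ k]. *)
Lemma leq_expn_iter_base_succ j x : j < k -> b ^ j %| x ->
  b ^ k <= iter ((k - j) * b) s x.
Proof.
move=> jk; have [d dE] : exists d, k - j = d.+1 by exists (k - j).-1; lia.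
elim: d j x jk dE => [|d IH] j x jk dE jx; rewrite dE.
  have kE : k = j.+1 by lia.
  suff iterE i : iter i s x = x + i * b ^ j.
    by rewrite mul1n iterE kE expnS leq_addl.
  elim: i => [|i IHi]; first by rewrite addn0.
  rewrite iterS IHi mulSn addnCA [RHS]addnC /base_succ; congr addn.
  by apply: base_widthE; [|rewrite dvdn_add ?dvdn_mull|rewrite -kE ltnn].
have jk1 : j.+1 < k by lia.
have [q xE] := dvdnP jx.
(* From [x = q * b ^ j], [b - q %% b] steps of [b ^ j] end at a multiple of [b ^ j.+1]. *)
have [|i ib isx] := iter_base_succ_dvd j (b - q %% b) x jk1 jx.
  rewrite xE -mulnDl expnS dvdn_mul //.
  rewrite {1}(divn_eq q b) -addnA subnKC; last by rewrite ltnW // ltn_pmod.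
  by rewrite dvdn_add ?dvdn_mull.
have kE : k - j.+1 = d.+1 by lia.
apply: leq_trans (IH _ _ jk1 kE isx) _.
rewrite -iterD kE; apply: leq_iter_base_succ2.
by rewrite [d.+2 * b]mulSn addnC leq_add2r (leq_trans ib) ?leq_subr.
Qed.

Lemma leq_expn_iter x : b ^ k <= iter (k * b) s x.
Proof.
by have := leq_expn_iter_base_succ 0 x; rewrite subn0 expn0 dvd1n; apply.
Qed.

(** * Adjacency and induced paths *)

Definition base_adj (x y : nat) := [&& x != y, x <= s y & y <= s x].
Local Notation adj := base_adj.

Lemma base_adj_sym : symmetric adj.
Proof. by move=> x y; rewrite /base_adj eq_sym [X in _ && X]andbC. Qed.

Lemma base_adj_irr : irreflexive adj.
Proof. by move=> x; rewrite /base_adj eqxx. Qed.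

Lemma base_adj_ltn {x y} : x < y -> adj x y = (y <= s x).
Proof.
move=> xy; rewrite /base_adj neq_ltn xy /=.
by rewrite (leq_trans (ltnW xy)) // leq_addr.
Qed.

(* If [y < s x], laminarity would make every neighbour of [y] adjacent to [x]. *)
Lemma base_adj_abut x y z : x < y -> adj x y -> adj y z -> x != z ->
  ~~ adj x z -> y = s x.
Proof.
move=> xy; rewrite (base_adj_ltn xy) => ysx yz xNz xzN.
apply/eqP; rewrite eqn_leq ysx /= leqNgt; apply: contra xzN => ysx'.
have syx := base_succ_laminar _ _ xy ysx'.
move: yz; rewrite /base_adj xNz => /and3P[yNz yz zy] /=.
rewrite (leq_trans (ltnW xy) yz) /=.
exact: leq_trans zy syx.
Qed.

Section InducedPath.
Variables (m : nat) (p : nat -> nat).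
Hypothesis p_inj : forall i j, i < m -> j < m -> i != j -> p i != p j.
Hypothesis p_adj : forall i j, i < m -> j < m ->
  adj (p i) (p j) = (i.+1 == j) || (j.+1 == i).

(** Both vertices are inner, so the one that starts later has another neighbour on the path, not
    adjacent to the first. *)
Lemma induced_path_step i : 0 < i -> i.+2 < m ->
  p i.+1 = s (p i) \/ p i = s (p i.+1).
Proof.
move=> i0 im; have : p i != p i.+1 by apply: p_inj; lia.
rewrite neq_ltn => /orP[] lt_p; [left|right].
  apply: (@base_adj_abut _ _ (p i.+2)) => //; rewrite ?p_adj ?p_inj; lia.
apply: (@base_adj_abut _ _ (p i.-1)) => //; rewrite ?p_adj ?p_inj; lia.
Qed.

(** Two intervals with a common right end meet. *)
Lemma induced_path_no_turn i : i.+2 < m ->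
  ~ (s (p i) = p i.+1 /\ s (p i.+2) = p i.+1).
Proof.
move=> im [s1 s2].
have : adj (p i) (p i.+2).
  rewrite /base_adj s1 s2 p_inj /=; [|lia..].
  by rewrite -{1}s1 -s2 !leq_addr.
by rewrite p_adj; lia.
Qed.

Lemma induced_path_up i : p 2 = s (p 1) -> i.+2 < m ->
  p i.+1 = iter i s (p 1).
Proof.
move=> p2 im.
(* The induction also carries the direction of the next step. *)
suff [] : p i.+1 = iter i s (p 1) /\ (i.+3 < m -> p i.+2 = s (p i.+1)) by [].
elim: i im => [//|i IH] im; have [|pi pS] := IH; first by lia.
have {}pS := pS im; split; first by rewrite pS pi.
move=> im'; have [//|//|//|pE] := @induced_path_step i.+2.
by case: (induced_path_no_turn i.+1 im); split.
Qed.

Lemma induced_path_down i : p 1 = s (p 2) -> i.+2 < m ->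
  p 1 = iter i s (p i.+1).
Proof.
move=> p1 im.
suff [] : p 1 = iter i s (p i.+1) /\ (i.+3 < m -> p i.+1 = s (p i.+2)) by [].
elim: i im => [//|i IH] im; have [|pi pS] := IH; first by lia.
have {}pS := pS im; split; first by rewrite iterSr -pS.
move=> im'; have [//|//|pE|//] := @induced_path_step i.+2.
(* A reversal would make both path neighbours of [p i.+2] equal to its successor. *)
suff : p i.+1 != p i.+3 by rewrite pS pE eqxx.
by apply: p_inj; lia.
Qed.

(** The 2 counts the end vertices: a longer path has [k * b + 1] consecutive inner ones, and the
    [k * b] steps of [s] between them reach [b ^ k]. *)
Lemma induced_path_leq : (forall i, i < m -> p i < b ^ k) -> m <= k * b + 2.
Proof.
move=> p_lt; rewrite leqNgt; apply/negP => m_gt.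
have kb : 0 < k * b by rewrite muln_gt0 k_gt0.
have big x := leq_expn_iter x.
have [||p2|p1] := @induced_path_step 1; [lia|lia|..].
  have := p_lt (k * b).+1; rewrite induced_path_up // ?ltnNge ?big; lia.
have := p_lt 1; rewrite (@induced_path_down (k * b)) // ?ltnNge ?big; lia.
Qed.

End InducedPath.

(** * The graph: its path, induced paths and cliques *)

Definition base_graph (n : nat) : sgraph :=
  @SGraph 'I_n (fun x y => adj x y) (fun x y => base_adj_sym x y)
    (fun x => base_adj_irr x).

Lemma path_subgraph_base_graph n : is_subgraph (path_graph n) (base_graph n).
Proof.
exists id; split=> // x y; rewrite /edge /= /path_edge.
have sx i : i < s i by rewrite /base_succ -ltn_subLR ?subnn ?base_width_gt0.
case/orP => /eqP xy; last rewrite base_adj_sym.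
  by rewrite base_adj_ltn -xy.
by rewrite base_adj_ltn -xy.
Qed.

Lemma longest_induced_path_base_graph n : n <= b ^ k ->
  longest_induced_path (base_graph n) <= k * b + 2.
Proof.
move=> nbk; apply/bigmax_leqP => -[m /= _] /asboolP[f [f_inj f_edge]].
(* The default 0 is harmless: only indices below [m] matter. *)
pose p i := if insub i is Some j then nat_of_ord (f j) else 0.
have pE i (im : i < m) : p i = f (Ordinal im) by rewrite /p insubT.
apply: (@induced_path_leq m p) => [i j im jm ij|i j im jm|i im].
- rewrite !pE; apply: contra ij => /eqP/val_inj/f_inj/(congr1 val)/= ->.
  exact: eqxx.
- by rewrite !pE; have := f_edge (Ordinal im) (Ordinal jm).
- by rewrite pE (leq_trans _ nbk).
Qed.

Lemma clique_number_base_graph n : clique_number (base_graph n) <= k.+1.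
Proof.
apply/bigmax_leqP => A /forall_inP A_clique.
have [->|[z zA]] := set_0Vmem A; first by rewrite cards0.
(* The start of the last interval lies in all intervals of the clique. *)
pose y := [arg max_(i > z in A) (i : 'I_n)].
have [yA y_max] : y \in A /\ forall x : 'I_n, x \in A -> x <= y.
  by rewrite /y; case: arg_maxnP.
rewrite (cardsD1 y) yA add1n ltnS.
have A'P (x : 'I_n) : x \in A :\ y -> [/\ x < y & y <= s x].
  rewrite !inE => /andP[xy xA].
  have lt_xy : x < y by rewrite ltn_neqAle y_max // andbT.
  have := A_clique _ xA => /forall_inP/(_ _ yA)/implyP/(_ xy).
  by rewrite /edge /= base_adj_ltn.
have w_inj : {in enum (A :\ y) &, injective (fun x : 'I_n => w x)}.
  suff lt_w (x x' : 'I_n) : x \in A :\ y -> x' \in A :\ y -> x < x' -> w x <> w x'.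
    move=> x x'; rewrite !mem_enum => xA x'A wE; apply/val_inj.
    by case: (ltngtP x x') => // [/lt_w|/lt_w] /(_ _ _)[].
  move=> /A'P[_ ysx] /A'P[x'y _] xx' wE.
  (* With equal widths the interval of [x] would end by [x'], before [y]. *)
  have : x + w x <= x' by apply: dvdn_gap; rewrite // ?dvdn_base_width // wE dvdn_base_width.
  by move: ysx; rewrite /base_succ; lia.
rewrite cardE -(size_map (fun x : 'I_n => w x)) -[leqRHS](size_iota 0).
rewrite -[leqRHS](size_map (expn b)); apply: uniq_leq_size.
  by rewrite (map_inj_in_uniq w_inj) enum_uniq.
move=> _ /mapP[x _ ->]; have [j [jk -> _]] := base_widthP x.
by rewrite map_f // mem_iota.
Qed.

End BaseIntervals.

(** * Interval representation and pathwidth *)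

Lemma interval_graph_base_graph (R : realType) (b k n : nat) :
  interval_graph R (base_graph b k n).
Proof.
pose s := base_succ b k.
have le_s (x : nat) : (x <= s x)%N by exact: leq_addr.
exists (fun x : 'I_n => `[x%:R : R, (s x)%:R]%classic); split=> [x|x y xNy].
  split; first by exists x%:R; rewrite /= in_itv /= lexx ler_nat le_s.
    exact: interval_is_interval.
  exact/compact_bounded/segment_compact.
have {}xNy : val x != val y by rewrite (inj_eq val_inj).
rewrite /edge /= /base_adj -/s; split.
  rewrite xNy /= => /andP[xy yx].
  (* The later left end is a common point. *)
  exists (maxn x y)%:R; split; rewrite /= in_itv /= !ler_nat.
    by rewrite leq_maxl geq_max le_s yx.
  by rewrite leq_maxr geq_max le_s xy.
move=> [z [/=]]; rewrite !in_itv /= => /andP[xz zx] /andP[yz zy].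
rewrite xNy /=; apply/andP; split; rewrite -(ler_nat R).
  exact: le_trans xz zy.
exact: le_trans yz zx.
Qed.

(** [G] serves as its own supergraph. A vertex makes its clique number positive, hence of the exact
    form [q.+1] demanded. *)
Lemma pathwidth_interval (R : realType) (G : sgraph) (p : nat) :
  interval_graph R G -> (0 < #|G|)%N -> (clique_number G <= p.+1)%N ->
  (pathwidth R G <= p)%N.
Proof.
move=> G_itv /card_gt0P[x _] Gp; rewrite /pathwidth.
case: ex_minnP => q _ q_min.
have clique1 : is_clique [set x].
  apply/forall_inP => y /set1P ->; apply/forall_inP => z /set1P ->.
  by rewrite eqxx.
have clique_gt0 : (0 < clique_number G)%N.
  by rewrite -(cards1 x); apply: (leq_bigmax_cond (F := fun A : {set G} => #|A|)).
apply: leq_trans (q_min (clique_number G).-1 _) _; last by lia.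
apply/asboolP; exists G; split; [exact: G_itv|by rewrite prednK|by exists id; split=> ? ?].
Qed.

Theorem theorem4 (R : realType) (k : nat) (hk : (0 < k)%N) :
  exists c : R, 0 < c /\
    forall n : nat, (0 < n)%N ->
      exists G : sgraph,
        [/\ (pathwidth R G <= k)%N,
            is_subgraph (path_graph n) G
          & (longest_induced_path G)%:R <= c * n%:R `^ (k%:R^-1)].
Proof.
(* From [b <= 2 * r] and [1 <= r], [k * b + 2] is at most [(2 * k + 2) * r]. *)
exists (2 * k%:R + 2); split=> [|n n_gt0].
  by rewrite ltr_wpDl ?mulr_ge0.
set r := n%:R `^ _.
have r_ge1 : 1 <= r.
  by rewrite -(powRr0 (n%:R : R)) ler_powR ?invr_ge0 // ler1n.
(* Rounding [r] up keeps [n = r ^+ k] below [b ^ k] and costs at most a factor 2. *)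
pose b := (Num.truncn r).+1.
have r_ltb : r < b%:R by exact: truncnS_gt.
have b_ler : b%:R <= 2 * r.
  rewrite /b -natr1 mulr_natl mulr2n lerD // truncn_le.
  exact: le_trans r_ge1.
have n_le : (n <= b ^ k)%N.
  rewrite -(ler_nat R) natrX.
  have -> : n%:R = r ^+ k.
    rewrite -powR_mulrn ?powR_ge0 // /r -powRrM mulVf ?powRr1 //.
    by rewrite pnatr_eq0 -lt0n.
  by rewrite lerXn2r ?nnegrE ?powR_ge0 // ltW.
exists (base_graph b k n); split.
- apply: pathwidth_interval; first exact: interval_graph_base_graph.
    by rewrite card_ord.
  exact: clique_number_base_graph.
- exact: path_subgraph_base_graph.
- have := longest_induced_path_base_graph b k (ltn0Sn _) hk n n_le.
  rewrite -(ler_nat R) => /le_trans; apply.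
  rewrite natrD natrM mulrDl; apply: lerD.
    by rewrite -mulrA mulrCA ler_wpM2l.
  by rewrite ler_peMr.
Qed.
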